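(* Let $G$ be a finite Abelian group and let $\iota\colon G\to G$, $\iota(x)=x^{-1}$, be the inversion automorphism of $G$. Then every generalized Cayley graph $GC(G,S,\iota)$ on $G$ with respect to $\iota$ is a Cayley graph if and only if one of the following holds: (i) $G$ is an elementary Abelian $2$-group; (ii) the Sylow $2$-subgroup of $G$ is cyclic.
   Context: Let $G$ be a group, $S\subseteq G$ and $\alpha\in\mathrm{Aut}(G)$ such that: (i) $\alpha^2=1$; (ii) $\alpha(x^{-1})x\notin S$ for every $x\in G$; (iii) for all $x,y\in G$, if $\alpha(x^{-1})y\in S$ then $\alpha(y^{-1})x\in S$ (given (i), this is equivalent to $\alpha(S^{-1})=S$). The generalized Cayley graph $GC(G,S,\alpha)$ is the (simple, undirected) graph with vertex set $G$ in which $x,y$ are adjacent iff $\alpha(x^{-1})y\in S$. If $\alpha=1$ it is called a Cayley graph and denoted $\mathrm{Cay}(G,S)$. A graph ''is a Cayley graph'' if it is isomorphic to $\mathrm{Cay}(H,T)$ for some group $H$ (not necessarily the given group $G$) and some admissible $T\subseteq H$. The set $S$ in $GC(G,S,\iota)$ may be empty. The trivial group counts as cyclic. *)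

(* Defs.v *)
From mathcomp Require Import all_boot all_fingroup all_solvable.

Set Implicit Arguments.
Unset Strict Implicit.
Unset Printing Implicit Defensive.

Local Open Scope group_scope.

(* A graph is given by its finite vertex set [A : {set T}] and a relation     *)
(* [e : rel T], of which only the restriction to [A] is relevant.             *)
Definition graph_iso (aT bT : finType) (A : {set aT}) (e : rel aT)
    (B : {set bT}) (e' : rel bT) : Prop :=
  exists f : aT -> bT,
    [/\ {in A &, injective f}, f @: A = B &
        {in A &, forall x y, e' (f x) (f y) = e x y}].

Section GeneralizedCayley.

Variable gT : finGroupType.
Implicit Types (G : {group gT}) (S : {set gT}) (alpha : {perm gT}).

(* Elements of [Aut G] are permutations of [gT] fixing every point outside    *)
(* [G], so [alpha ^+ 2 = 1] only constrains [alpha] on [G].                   *)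
Definition gcayley_admissible G S alpha : Prop :=
  [/\ S \subset G,
      alpha \in Aut G,
      alpha ^+ 2 = 1,
      {in G, forall x, alpha (x^-1) * x \notin S} &
      {in G &, forall x y, alpha (x^-1) * y \in S -> alpha (y^-1) * x \in S}].

Definition gcayley_rel S alpha : rel gT :=
  fun x y => alpha (x^-1) * y \in S.

Lemma gcayley_irr G S alpha :
  gcayley_admissible G S alpha -> {in G, irreflexive (gcayley_rel S alpha)}.
Proof. by case=> _ _ _ irrS _ x Gx; apply/negbTE/irrS. Qed.

Lemma gcayley_sym G S alpha :
  gcayley_admissible G S alpha -> {in G &, symmetric (gcayley_rel S alpha)}.
Proof. by case=> _ _ _ _ symS x y Gx Gy; apply/idP/idP; apply: symS. Qed.

End GeneralizedCayley.

Definition is_cayley_graph (T : finType) (A : {set T}) (e : rel T) : Prop :=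
  exists (hT : finGroupType) (H : {group hT}) (S : {set hT}),
    gcayley_admissible H S 1 /\ graph_iso A e H (gcayley_rel S 1).

Section InversionAutomorphism.

Variables (gT : finGroupType) (G : {group gT}).

Fact inv_perm_subproof : [set x^-1 | x in G] \subset G.
Proof. by apply/subsetP=> _ /imsetP[x Gx ->]; rewrite groupV. Qed.

(* Inversion on [G] and the identity outside, as [Aut G] requires.            *)
Definition inv_perm : {perm gT} :=
  perm_in (in2W (@invg_inj gT)) inv_perm_subproof.

Lemma inv_permE : {in G, forall x, inv_perm x = x^-1}.
Proof. by move=> x Gx; rewrite perm_inE. Qed.

Lemma inv_perm_Aut : abelian G -> inv_perm \in Aut G.
Proof.
move=> cGG; rewrite inE perm_in_on; apply/morphicP=> x y Gx Gy.
by rewrite !inv_permE ?groupM // invMg (centsP cGG) ?groupV.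
Qed.

End InversionAutomorphism.

(* Main.v *)
(* Adjacency in [GC(G, S, iota)] means [x * y \in S], where [S] contains no
   square.

   If the Sylow 2-subgroup is cyclic, a product of two non-squares of [G] is a
   square, so every edge joins a square to a non-square. The maps multiplying
   squares by [k] and non-squares by [k^-1] (for [k] in [G]) preserve the
   products along edges, and they form a group acting regularly on [G].

   If the Sylow 2-subgroup [P] is not cyclic, choose [a, b] in [P] such that
   none of [a], [b], [a * b] is a square, and take [S = {a, b, a * b}]. The
   number of triangles through [x] is the number of elements of the list
   [1, a^2, b^2] that are equal to [x^2]. A Cayley graph is vertex-transitive;
   comparing the vertices [1], [a], [b], [a * b] and [a^2], and using that [a] is
   a 2-element, one gets that [x^2 = 1] for all [x] in [G]. *)
Require Import Defs.
From mathcomp Require Import all_boot all_fingroup all_solvable.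

Set Implicit Arguments.
Unset Strict Implicit.
Unset Printing Implicit Defensive.

Local Open Scope group_scope.

(** * Cayley graphs from regular automorphism groups *)

Lemma cayley_admissible (hT : finGroupType) (H : {group hT}) (T : {set hT}) :
  T \subset H -> 1 \notin T -> {in T, forall x, x^-1 \in T} ->
  gcayley_admissible H T 1.
Proof.
move=> sTH T1 TV; split=> //; rewrite ?group1 ?expg1n //.
  by move=> x _; rewrite perm1 mulVg.
by move=> x y _ _; rewrite !perm1 => /TV; rewrite invMg invgK.
Qed.

(* Sabidussi's theorem. Products in [{perm T}] compose from left to right, so
   the vertex [r x0] has to correspond to [r^-1]. *)
Lemma regular_is_cayley (T : finType) (A : {set T}) (e : rel T)
    (R : {group {perm T}}) (x0 : T) :
    x0 \in A ->
    {in A, irreflexive e} -> {in A &, symmetric e} ->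
    {in R & A, forall (r : {perm T}) x, r x \in A} ->
    {in R, forall r : {perm T}, {in A &, {mono r : x y / e x y}}} ->
    {in A, forall x, exists2 r : {perm T}, r \in R & r x0 = x} ->
    {in R &, forall r s : {perm T}, r x0 = s x0 -> r = s} ->
  is_cayley_graph A e.
Proof.
move=> Ax0 irr_e sym_e RA Re Rtrans Rfree.
(* Transitivity makes the choice succeed on all of [A]; the default [1] only serves points outside
   [A]. *)
pose g x : {perm T} := odflt 1 [pick r in R | r x0 == x].
have gP x : x \in A -> g x \in R /\ g x x0 = x.
  rewrite /g => Ax; case: pickP => [r /andP[Rr /eqP] // | no_r].
  by have [r Rr rx] := Rtrans x Ax; have:= no_r r; rewrite Rr rx eqxx.
exists {perm T}, R, [set r in R | e x0 (r x0)]; split.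
  apply: cayley_admissible => [||r].
  - by apply/subsetP=> r; rewrite inE => /andP[].
  - by rewrite inE group1 perm1 irr_e.
  rewrite !inE => /andP[Rr er]; rewrite groupV Rr.
  by rewrite -(Re r Rr) ?RA ?groupV // permKV sym_e ?RA.
exists (fun x => (g x)^-1); split.
- move=> x y Ax Ay /invg_inj eqg.
  by have [_ <-] := gP x Ax; have [_ <-] := gP y Ay; rewrite eqg.
- apply/setP=> r; apply/imsetP/idP => [[x Ax ->] | Rr].
    by have [Rg _] := gP x Ax; rewrite groupV.
  have AVr : r^-1 x0 \in A by rewrite RA ?groupV.
  have [Rg gx] := gP _ AVr.
  exists (r^-1 x0) => //; apply: invg_inj; rewrite invgK.
  by apply: Rfree; rewrite ?groupV.
move=> x y Ax Ay; have [Rgx gx] := gP x Ax; have [Rgy gy] := gP y Ay.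
rewrite /gcayley_rel perm1 invgK inE groupM ?groupV //= permM gx.
rewrite -(Re (g y)) ?RA ?groupV // permKV gy.
by rewrite sym_e.
Qed.

(** * Triangle counts as an obstruction to being a Cayley graph *)

(* Each triangle through [x] is counted twice. *)
Definition triangles (T : finType) (A : {set T}) (e : rel T) (x : T) : nat :=
  \sum_(u in A) \sum_(v in A) [&& e x u, e x v & e u v].

(** Left translation by [y] leaves every quotient [u^-1 * v] unchanged, so it is an automorphism
    carrying [1] to [y]; both sums are reindexed along it. *)
Lemma triangles_cayley (hT : finGroupType) (H : {group hT}) (T : {set hT}) :
  {in H, forall y, triangles H (gcayley_rel T 1) y
                   = triangles H (gcayley_rel T 1) 1}.
Proof.
move=> y Hy; rewrite /triangles /gcayley_rel.
rewrite (reindex_inj (mulgI y)); apply: eq_big => [u | u Hu].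
  exact: groupMl.
rewrite (reindex_inj (mulgI y)); apply: eq_big => [v | v Hv].
  exact: groupMl.
by rewrite !perm1 invg1 !mul1g !invMg !mulgA !mulgKV !mulVg !mul1g.
Qed.

Lemma cayley_triangles_const (T : finType) (A : {set T}) (e : rel T) :
  is_cayley_graph A e -> {in A &, forall x y, triangles A e x = triangles A e y}.
Proof.
case=> hT [H [S [_ [f [inj_f fA fe]]]]].
suffices tri_f x : x \in A ->
    triangles H (gcayley_rel S 1) (f x) = triangles A e x.
  move=> x y Ax Ay; rewrite -!tri_f // !triangles_cayley // -fA;
  exact: imset_f.
move=> Ax; rewrite /triangles -fA big_imset //; apply: eq_bigr => u Au.
rewrite big_imset //; apply: eq_bigr => v Av.
by rewrite !fe.
Qed.

(** * Admissible sets for inversion, and squares in an abelian group *)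

Section InversionGraph.

Variables (gT : finGroupType) (G : {group gT}).
Implicit Type S : {set gT}.

Lemma inv_gcayley_relE S x y :
  x \in G -> gcayley_rel S (inv_perm G) x y = (x * y \in S).
Proof. by move=> Gx; rewrite /gcayley_rel inv_permE ?groupV // invgK. Qed.

Hypothesis cGG : abelian G.

Let mulGC : {in G &, forall x y, x * y = y * x}.
Proof. by move=> x y Gx Gy; apply: (centsP cGG). Qed.

(** Adjacency is [x * y \in S], so commutativity gives symmetry and only loops, that is squares,
    have to be excluded. *)
Lemma inv_gcayley_admissible S :
  S \subset G -> {in G, forall x, x ^+ 2 \notin S} ->
  gcayley_admissible G S (inv_perm G).
Proof.
move=> sSG S2; split=> //; first exact: inv_perm_Aut.
- apply/permP=> x; rewrite expgS expg1 permM perm1.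
  have [Gx | nGx] := boolP (x \in G); first by rewrite !inv_permE ?groupV ?invgK.
  by have /(out_perm (perm_in_on _ _)) E := nGx; rewrite /inv_perm !E.
- by move=> x Gx; rewrite inv_permE ?groupV // invgK -expg2 S2.
move=> x y Gx Gy; rewrite !inv_permE ?groupV // !invgK.
by rewrite mulGC.
Qed.

Definition squares := [set x ^+ 2 | x in G].

Lemma squaresP x : reflect (exists2 g, g \in G & x = g ^+ 2) (x \in squares).
Proof. exact: imsetP. Qed.

Lemma squaresM : {in squares &, forall x y, x * y \in squares}.
Proof.
move=> _ _ /squaresP[g Gg ->] /squaresP[h Gh ->].
by rewrite -(expgMn _ (mulGC Gg Gh)); apply: imset_f; apply: groupM.
Qed.

Lemma squaresV x : x \in squares -> x^-1 \in squares.
Proof. by case/squaresP=> g Gg ->; rewrite -expgVn; apply: imset_f; rewrite groupV. Qed.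

Lemma squaresMl x y : x \in squares -> (x * y \in squares) = (y \in squares).
Proof.
move=> Qx; apply/idP/idP=> [/(squaresM (squaresV Qx)) | /(squaresM Qx) //].
by rewrite mulKg.
Qed.

Lemma squares_odd x : x \in G -> odd #[x] -> x \in squares.
Proof.
move=> Gx odd_x; apply/squaresP; exists (x ^+ (#[x].+1)./2).
  exact: groupX.
by rewrite -expgM muln2 halfK /= odd_x subn0 expgS expg_order mulg1.
Qed.

(** The [2']-part of an element has odd order, hence is a square, and its [2]-part is a power of a
    generator [c] of [P]. In a non-square the exponent of [c] must be odd, and two odd exponents
    have an even sum. *)
Lemma squares_mul_nonsquares (P : {group gT}) :
  2.-Sylow(G) P -> cyclic P ->
  {in G &, forall x y, x \notin squares -> y \notin squares ->
                       x * y \in squares}.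
Proof.
move=> sylP /cyclicP[c defP].
have Gc : c \in G by rewrite (subsetP (pHall_sub sylP)) // defP cycle_id.
have sqc i : ~~ odd i -> c ^+ i \in squares.
  move=> ev_i; apply/squaresP; exists (c ^+ i./2); first exact: groupX.
  by rewrite -expgM muln2 halfK (negPf ev_i) subn0.
have decomp x : x \in G -> exists i, exists2 q, q \in squares & x = q * c ^+ i.
  move=> Gx.
  have: x.`_2 \in P.
    rewrite (mem_normal_Hall sylP) ?p_elt_constt ?groupX //.
    by rewrite -(sub_abelian_normal _ cGG) (pHall_sub sylP).
  rewrite defP => /cycleP[i xi]; exists i; exists x.`_2^'.
    by rewrite squares_odd ?groupX // odd_2'nat; apply: p_elt_constt.
  by rewrite -xi mulGC ?groupX // consttC.
have nsq q i : q \in squares -> q * c ^+ i \notin squares -> odd i.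
  by move=> Qq; rewrite squaresMl //; apply: contraR => /sqc.
have sqG : {subset squares <= G} by move=> _ /squaresP[g Gg ->]; apply: groupX.
move=> _ _ /decomp[i [p Qp ->]] /decomp[j [q Qq ->]].
move=> /(nsq _ _ Qp) odd_i /(nsq _ _ Qq) odd_j.
rewrite -mulgA squaresMl // mulgA (mulGC _ (sqG q Qq)) ?groupX // -mulgA.
by rewrite squaresMl // -expgD sqc // oddD odd_i odd_j.
Qed.

(** * Sufficiency of the two conditions *)

Lemma cyclic_sylow_cayley (P : {group gT}) S :
    2.-Sylow(G) P -> cyclic P -> gcayley_admissible G S (inv_perm G) ->
  is_cayley_graph G (gcayley_rel S (inv_perm G)).
Proof.
move=> sylP cycP admS; have [sSG _ _ irrS _] := admS.
have nSQ x : x \in squares -> x \notin S.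
  case/squaresP=> g Gg ->; have := irrS g Gg.
  by rewrite inv_permE ?groupV // invgK -expg2.
have sqM : {in G &, forall x y,
    (x * y \in squares) = ((x \in squares) == (y \in squares))}.
  move=> x y Gx Gy; have [Qx | nQx] := boolP (x \in squares).
    exact: squaresMl.
  have [Qy | nQy] := boolP (y \in squares).
    by rewrite mulGC // squaresMl // (negPf nQx).
  by rewrite (squares_mul_nonsquares sylP cycP).
have sqV x : x \in G -> (x^-1 \in squares) = (x \in squares).
  by move=> Gx; apply/idP/idP => /squaresV; rewrite ?invgK.
have sq1 : 1 \in squares by apply/squaresP; exists 1; rewrite ?group1 ?expg1n.
pose tw k x := if x \in squares then k * x else k^-1 * x.
have twG : {in G &, forall k x, tw k x \in G}.
  by move=> k x Gk Gx; rewrite /tw; case: ifP; rewrite groupM ?groupV.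
have twQ : {in G &, forall k x,
    (tw k x \in squares) = ((k \in squares) == (x \in squares))}.
  by move=> k x Gk Gx; rewrite /tw; case: ifP; rewrite sqM ?groupV ?sqV // => ->.
(* Since [tw k 1 = k], the image of [1] determines [r] on [G]; [perm_on G] fixes it elsewhere, which
   makes the action free. *)
pose Rset := [set r : {perm gT} | perm_on G r &
  [exists k in G, [forall x in G, r x == tw k x]]].
have RP r : reflect (perm_on G r /\ exists2 k, k \in G & {in G, r =1 tw k})
                    (r \in Rset).
  rewrite inE; apply: (iffP andP) => [] [onr]; split=> //.
    by case/exists_inP: b => k Gk /eqfun_inP; exists k.
  by case: b => k Gk rk; apply/exists_inP; exists k => //; apply/eqfun_inP.
have gR : group_set Rset.
  apply/group_setP; split=> [|r s].
    apply/RP; split; first exact: perm_on1.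
    exists 1; rewrite ?group1 // => x Gx.
    by rewrite perm1 /tw invg1 mul1g if_same.
  case/RP=> onr [k Gk rk] /RP[ons [l Gl sl]]; apply/RP; split.
    exact: perm_onM.
  (* On [G], [tw k] exchanges squares and non-squares exactly when [k] is a non-square; hence
     [tw l (tw k x) = tw (tw l k) x]. *)
  exists (tw l k); first exact: twG.
  move=> x Gx; rewrite permM rk // sl ?twG //.
  rewrite {1}/tw twQ // /tw.
  case: (k \in squares); case: (x \in squares) => /=;
    rewrite ?mulgA ?invMg ?invgK //.
  - by rewrite (mulGC (groupVr Gk)) ?groupV.
  - by rewrite (mulGC (groupVr Gk)).
apply: (@regular_is_cayley _ _ _ (Group gR) 1) => //=.
- exact: gcayley_irr admS.
- exact: gcayley_sym admS.
- by move=> r x /RP[_ [k Gk rk]] Gx; rewrite rk ?twG.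
- move=> r /RP[_ [k Gk rk]] x y Gx Gy.
  rewrite !inv_gcayley_relE ?rk ?twG //.
  (* If [x] and [y] are both squares or both non-squares, so are their images; both products are
     then squares, and neither lies in [S]. Otherwise the factors [k] and [k^-1] cancel in the
     product. *)
  have [eqQ | neQ] := boolP ((x \in squares) == (y \in squares)).
    by rewrite !(negPf (nSQ _ _)) ?sqM ?twG ?twQ //;
       rewrite (eqP eqQ) eqxx.
  congr (_ \in S); move: neQ; rewrite /tw.
  case: (x \in squares); case: (y \in squares) => // _.
    by rewrite (mulGC Gk Gx) -mulgA mulKVg.
  by rewrite (mulGC (groupVr Gk) Gx) -mulgA mulKg.
- move=> k Gk.
  (* By [twQ], points with equal images are both squares or both non-squares, and on each of these
     classes [tw k] is a translation. *)
  have tw_inj : {in G &, injective (tw k)}.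
    move=> x y Gx Gy eq_tw.
    have /eqP := congr1 (mem squares) eq_tw.
    rewrite /= !twQ // => eqQ.
    have eqxy : (x \in squares) = (y \in squares).
      by move: eqQ; do 3!case: (_ \in squares).
    by move: eq_tw; rewrite /tw eqxy; case: ifP => _ /mulgI.
  have tw_im : [set tw k x | x in G] \subset G.
    by apply/subsetP=> _ /imsetP[x Gx ->]; apply: twG.
  exists (perm_in tw_inj tw_im); last by rewrite perm_inE ?group1 // /tw sq1 mulg1.
  apply/RP; split; first exact: perm_in_on.
  by exists k => // x Gx; rewrite perm_inE.
move=> r s /RP[onr [k Gk rk]] /RP[ons [l Gl sl]].
rewrite rk // sl // /tw sq1 !mulg1 => eq_kl.
apply/permP=> x; have [Gx | nGx] := boolP (x \in G).
  by rewrite rk // sl // eq_kl.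
by rewrite !(out_perm _ nGx).
Qed.

(** Inversion is trivial on [G], so the identity map is already an isomorphism onto the Cayley graph
    of the same [S]. *)
Lemma elementary_cayley S :
    2.-abelem G -> gcayley_admissible G S (inv_perm G) ->
  is_cayley_graph G (gcayley_rel S (inv_perm G)).
Proof.
move=> abelG [sSG _ _ irrS _].
have [_ x2] := abelemP (isT : prime 2) abelG.
have invE x : x \in G -> x^-1 = x.
  by move=> Gx; apply/eqP; rewrite eq_invg_mul -expg2 x2.
exists gT, G, S; split.
  apply: cayley_admissible => // [|x Sx].
    by have := irrS 1 (group1 G); rewrite inv_permE ?groupV // invgK mulg1.
  by rewrite invE ?(subsetP sSG).
exists id; split=> [//||x y Gx Gy]; first exact: imset_id.
by rewrite inv_gcayley_relE // /gcayley_rel perm1 invE.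
Qed.

(** * Necessity of the two conditions *)

(** Squares lying in [P] belong to ['Phi(P)], so it suffices to take [a] outside ['Phi(P)] and [b]
    outside the subgroup generated by ['Phi(P)] and [a]. If either choice failed, [P] would be
    generated by at most one element, as ['Phi(P)] consists of non-generators. *)
Lemma noncyclic_nonsquares (P : {group gT}) :
    2.-Sylow(G) P -> ~~ cyclic P ->
  exists a b, [/\ a \in P, b \in P &
    [/\ a \notin squares, b \notin squares & a * b \notin squares]].
Proof.
move=> sylP ncycP; have pP := pHall_pgroup sylP.
have abP : abelian P := abelianS (pHall_sub sylP) cGG.
have QPhi x : x \in P -> x \in squares -> x \in 'Phi(P).
  move=> Px /squaresP[g Gg xE].
  (* The root [g] may lie outside [P], but [x] is its own [2]-part, so it is the square of the
     [2]-part of [g], which lies in [P]. *)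
  rewrite (Phi_Mho pP abP) -(constt_p_elt (mem_p_elt pP Px)) xE consttX.
  have Pg : g.`_2 \in P.
    rewrite (mem_normal_Hall sylP) ?p_elt_constt ?groupX //.
    by rewrite -(sub_abelian_normal _ cGG) (pHall_sub sylP).
  by apply: (Mho_p_elt 1 Pg); apply: p_elt_constt.
have [a Pa nPhia] : exists2 a, a \in P & a \notin 'Phi(P).
  apply/subsetPn; apply: contra ncycP => sPPhi.
  suffices <- : <<[set 1 : gT]>> = P :> {set gT} by rewrite cycle_cyclic.
  apply: Phi_nongen; apply/eqP; rewrite eqEsubset join_subG Phi_sub sub1G.
  by rewrite (subset_trans sPPhi) ?joing_subl.
have [b Pb nAb] : exists2 b, b \in P & b \notin 'Phi(P) <*> [set a].
  apply/subsetPn; apply: contra ncycP => sPPhi.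
  suffices <- : <<[set a]>> = P :> {set gT} by rewrite cycle_cyclic.
  apply: Phi_nongen; apply/eqP; rewrite eqEsubset join_subG Phi_sub sub1set Pa.
  by rewrite sPPhi.
have Aa : a \in 'Phi(P) <*> [set a] by rewrite mem_gen // inE set11 orbT.
have PhiA : 'Phi(P) \subset 'Phi(P) <*> [set a] := joing_subl _ _.
exists a, b; split=> //; split.
- by apply: contra nPhia; apply: QPhi.
- by apply: contra nAb => /(QPhi _ Pb) /(subsetP PhiA).
apply: contra nAb => /(QPhi _ (groupM Pa Pb)) /(subsetP PhiA).
by rewrite groupMl.
Qed.

(** Neighbours of [x] are [x^-1 * s] with [s] in [S], and those for [s] and [t] are adjacent iff
    [s * t * x ^- 2] is in [S]. For [s = t] this is a square, hence never in [S]; each of the three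
    unordered pairs gives one summand, and the two orders give the doubling. *)
Lemma triangles_nonsquares a b x :
    a \in G -> b \in G -> x \in G ->
    a \notin squares -> b \notin squares -> a * b \notin squares ->
  triangles G (gcayley_rel (a |: (b |: [set a * b])) (inv_perm G)) x
    = ((x ^+ 2 == 1) + (x ^+ 2 == a ^+ 2) + (x ^+ 2 == b ^+ 2)).*2.
Proof.
move=> Ga Gb Gx nQa nQb nQab; set S := (a |: _).
have Gab := groupM Ga Gb.
have sSG : S \subset G by rewrite !subUset !sub1set Ga Gb Gab.
have Qsq g : g \in G -> g ^+ 2 \in squares by move=> Gg; apply: imset_f.
have -> : triangles G (gcayley_rel S (inv_perm G)) x =
    \sum_(s in S) \sum_(t in S) ((s * t * x ^- 2)%g \in S).
  rewrite /triangles (reindex_inj (mulgI x^-1)) /=.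
  rewrite big_mkcond [RHS]big_mkcond; apply: eq_bigr => s _.
  rewrite groupMl ?groupV //; have [Ss | nSs] := boolP (s \in S); last first.
    case: ifP => // Gs; rewrite big1 // => v Gv.
    by rewrite inv_gcayley_relE // mulKVg (negPf nSs).
  have Gs := subsetP sSG s Ss; rewrite Gs (reindex_inj (mulgI x^-1)) /=.
  rewrite big_mkcond [RHS]big_mkcond; apply: eq_bigr => t _.
  rewrite groupMl ?groupV // 2?inv_gcayley_relE // !mulKVg Ss /=.
  have [St | nSt] := boolP (t \in S); last by rewrite if_same.
  have Gt := subsetP sSG t St; rewrite Gt inv_gcayley_relE ?groupM ?groupV //=.
  rewrite (mulGC (groupVr Gx) Gs) -!mulgA (mulgA x^-1) -invMg -expg2.
  by rewrite (mulGC (groupVr (groupX 2 Gx)) Gt).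
(* Each way of writing [u] as an element of [S] times [v] yields the condition [x ^+ 2 == v]; below,
   only one of the three [v] can be a square. *)
have memS u v1 v2 v3 : u = a * v1 -> u = b * v2 -> u = a * b * v3 ->
    (u * x ^- 2 \in S) = [|| x ^+ 2 == v1, x ^+ 2 == v2 | x ^+ 2 == v3].
  have eq_cancel c v : (c * v * x ^- 2 == c) = (x ^+ 2 == v).
    by rewrite -mulgA -{2}[c]mulg1 (inj_eq (mulgI c)) -eq_mulgV1 eq_sym.
  move=> u1 u2 u3; rewrite !in_setU1 inE {1}u1 {1}u2 {1}u3.
  by rewrite !eq_cancel.
have nsq v : v \notin squares -> (x ^+ 2 == v) = false.
  by move=> nQv; apply/eqP=> xv; rewrite -xv Qsq in nQv.
have diag s : s \in G -> (s * s * x ^- 2 \in S) = false.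
  move=> Gs; have: s * s * x ^- 2 \in squares.
    by rewrite -expg2 squaresMl ?squaresV ?Qsq.
  rewrite !in_setU1 inE => Qs.
  by apply/or3P=> -[] /eqP E; move: Qs; rewrite E; apply/negP.
have Sab : (a * b * x ^- 2 \in S) = (x ^+ 2 == 1).
  rewrite (memS _ b a 1) ?mulg1 //; last exact: mulGC.
  by rewrite (nsq b) ?(nsq a).
have Saab : (a * (a * b) * x ^- 2 \in S) = (x ^+ 2 == a ^+ 2).
  rewrite (memS _ (a * b) (a ^+ 2) a) //; first by rewrite (nsq a) ?(nsq (a * b)) ?orbF.
    by rewrite mulgA -expg2 mulGC ?groupX.
  exact: mulGC.
have Sbab : (b * (a * b) * x ^- 2 \in S) = (x ^+ 2 == b ^+ 2).
  rewrite (memS _ (b ^+ 2) (a * b) b) //; first by rewrite (nsq b) ?(nsq (a * b)) ?orbF.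
    by rewrite mulgA (mulGC Gb Ga) -mulgA.
  exact: mulGC.
have nQ1 c : c \notin squares -> 1 != c.
  by apply: contraNneq => <-; rewrite -(expg1n _ 2) Qsq.
have nab : a != b by apply: contraNneq nQab => ->; rewrite -expg2 Qsq.
have na_ab : a != a * b by rewrite -{1}[a]mulg1 (inj_eq (mulgI a)) nQ1.
have nb_ab : b != a * b by rewrite -{1}[b]mul1g (inj_eq (mulIg b)) nQ1.
have bigS (F : gT -> nat) : \sum_(s in S) F s = (F a + (F b + F (a * b)%g))%N.
  by rewrite !big_setU1 ?big_set1 //= !inE ?negb_or ?nab.
rewrite !bigS !diag // (mulGC Gb Ga) (mulGC Gab Ga) (mulGC Gab Gb).
rewrite Sab Saab Sbab.
by case: (_ == 1); case: (_ == a ^+ 2); case: (_ == b ^+ 2).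
Qed.

Lemma noncyclic_sylow_abelem (P : {group gT}) :
    (forall S, gcayley_admissible G S (inv_perm G) ->
       is_cayley_graph G (gcayley_rel S (inv_perm G))) ->
    2.-Sylow(G) P -> ~~ cyclic P ->
  2.-abelem G.
Proof.
move=> allC sylP ncycP.
have [a [b [Pa Pb [nQa nQb nQab]]]] := noncyclic_nonsquares sylP ncycP.
have sPG := subsetP (pHall_sub sylP).
have [Ga Gb] := (sPG a Pa, sPG b Pb); have Gab := groupM Ga Gb.
have /allC/cayley_triangles_const triC :
    gcayley_admissible G (a |: (b |: [set a * b])) (inv_perm G).
  apply: inv_gcayley_admissible; first by rewrite !subUset !sub1set Ga Gb Gab.
  move=> x Gx; have: x ^+ 2 \in squares by apply: imset_f.
  rewrite !in_setU1 inE => Qx.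
  by apply/or3P=> -[] /eqP E; move: Qx; rewrite E; apply/negP.
pose n x := (x ^+ 2 == 1) + (x ^+ 2 == a ^+ 2) + (x ^+ 2 == b ^+ 2).
have nC x : x \in G -> n x = n 1.
  by move=> Gx; apply: double_inj; rewrite -!triangles_nonsquares //; exact: triC.
apply/abelemP=> //; split=> // x Gx.
have := nC a Ga; have := nC b Gb; rewrite /n expg1n !eqxx.
rewrite ![1 == _]eq_sym [b ^+ 2 == a ^+ 2]eq_sym.
(* If [a ^+ 2 = 1], then [n b = n 1] forces [b ^+ 2 = 1], so [n] is constantly 3 and every [x ^+ 2]
   is [1]. *)
have [a1 | na1] := eqVneq (a ^+ 2) 1.
  rewrite a1 [1 == _]eq_sym; have [b1 _ _ | //] := eqVneq (b ^+ 2) 1.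
  by have:= nC x Gx; rewrite /n a1 b1 expg1n eqxx; case: eqP.
(* Here [n 1 = 2]: the vertex [a] requires [a ^+ 2 = b ^+ 2], while the vertex [b] excludes it. *)
have [_ | nb1] := eqVneq (b ^+ 2) 1; first by case: (_ == _).
have [// | nab _ _] := eqVneq (a ^+ 2) (b ^+ 2).
(* Now [n 1 = 1], so each square equals one of [1], [a ^+ 2], [b ^+ 2]; this is applied to the
   squares of [a * b] and [a ^+ 2]. *)
have sqE y : y \in G -> [|| y ^+ 2 == 1, y ^+ 2 == a ^+ 2 | y ^+ 2 == b ^+ 2].
  move/nC; rewrite /n expg1n eqxx ![1 == _]eq_sym (negPf na1) (negPf nb1).
  by do 3!case: (_ == _).
have ab1 : a ^+ 2 * b ^+ 2 = 1.
  have := sqE _ Gab; rewrite (expgMn _ (mulGC Ga Gb)) => /or3P[/eqP // | |].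
    by rewrite -{2}[a ^+ 2]mulg1 (inj_eq (mulgI _)) (negPf nb1).
  by rewrite -{2}[b ^+ 2]mul1g (inj_eq (mulIg _)) (negPf na1).
have := sqE _ (groupX 2 Ga); rewrite expg2 => /or3P[||/eqP a4].
- by rewrite -[X in _ == X]ab1 (inj_eq (mulgI _)) (negPf nab).
- by rewrite -{3}[a ^+ 2]mulg1 (inj_eq (mulgI _)) (negPf na1).
(* From [a ^+ 4 = b ^+ 2] and [a ^+ 2 * b ^+ 2 = 1] follows [a ^+ 6 = 1]. As [a] is a [2]-element,
   its order divides 2, contradicting [na1]. *)
have: #[a] %| (2 * 3)%N by rewrite order_dvdn -[a ^+ _]/(a ^+ (2 + (2 + 2))) !expgD a4 ab1.
have p2a : 2.-nat #[a] := mem_p_elt (pHall_pgroup sylP) Pa.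
by rewrite Gauss_dvdl ?(pnat_coprime p2a) // order_dvdn (negPf na1).
Qed.

End InversionGraph.

Theorem theorem3p5 (gT : finGroupType) (G : {group gT}) (cGG : abelian G) :
  (forall S : {set gT}, gcayley_admissible G S (inv_perm G) ->
     is_cayley_graph G (gcayley_rel S (inv_perm G))) <->
  (2.-abelem G \/ (forall P : {group gT}, 2.-Sylow(G) P -> cyclic P)).
Proof.
split=> [allC | [abelG | cycP] S admS].
- have [abelG | nabelG] := boolP (2.-abelem G); [by left | right => P sylP].
  apply: contraNT nabelG; exact: noncyclic_sylow_abelem sylP.
- exact: elementary_cayley.
have [P sylP] := Sylow_exists 2 G.
exact: cyclic_sylow_cayley sylP (cycP P sylP) admS.
Qed.
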